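(* Let $M\in\mathbb{N}$, $\delta,\varepsilon>0$, let $\mu$ be a distribution on $\{0,1\}^n\times\{0,1\}^n$ and let $f\colon\{0,1\}^n\times\{0,1\}^n\to\{0,1\}$ be such that $(f,\mu)$ has $(\varepsilon,\delta)$ relative-discrepancy. If $\Pi$ is a protocol with $I^{\mathrm{ext}}_{\mu}[\Pi]\le M$, then \[ \Pr_{(x,y)\sim\mu}[\mathrm{output}(\Pi(x,y))=f(x,y)]\le\frac12+2000\max\Big(\varepsilon,\frac{M}{\log(1/\delta)}\Big). \]
   Context: Protocols are two-party randomized communication protocols (Alice holds $x$, Bob holds $y$; output is a function of the transcript $\Pi(x,y)$). With $(X,Y)\sim\mu$, $I^{\mathrm{ext}}_\mu[\Pi]=I(\Pi(X,Y);X,Y)$ (base-2 logs). $(f,\mu)$ has $(\varepsilon,\delta)$ relative-discrepancy with respect to a distribution $\rho$ on $\{0,1\}^n\times\{0,1\}^n$ if for every rectangle $R=A\times B\subseteq\{0,1\}^n\times\{0,1\}^n$ with $\rho(R)\ge\delta$ we have $\mu(R\cap f^{-1}(0))\ge(\frac12-\varepsilon)\rho(R)$ and $\mu(R\cap f^{-1}(1))\ge(\frac12-\varepsilon)\rho(R)$; $(f,\mu)$ has $(\varepsilon,\delta)$ relative-discrepancy if this holds with respect to some distribution $\rho$.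
   Formalization: The formal statement additionally assumes δ < 1: at δ = 1 the quotient M/log(1/δ) divides by zero, and for δ > 1 relative-discrepancy is vacuous and the claim fails (e.g. f constant, M = 0, ε small). *)

(* Defs.v *)
From HB Require Import structures.
From mathcomp Require Import all_boot all_order all_algebra.
From mathcomp Require Import reals exp.
Set Implicit Arguments. Unset Strict Implicit. Unset Printing Implicit Defensive.
Import Order.TTheory GRing.Theory Num.Theory.
Local Open Scope ring_scope.

Definition bits (n : nat) := n.-tuple bool.

Definition log2 {R : realType} (x : R) : R := ln x / ln 2.

Definition is_dist {R : realType} {T : finType} (mu : T -> R) : Prop :=
  (forall z, 0 <= mu z) /\ \sum_z mu z = 1.

(* Two-party randomized protocol trees. At an Alice node (ANode p c0 c1),
   Alice (holding x) sends bit 1 with probability p x (then continue with c1)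
   and bit 0 with probability 1 - p x (continue with c0); Bob nodes likewise
   with his input y. The randomness is arbitrary (private coins; public coins
   are Alice/Bob nodes whose probability does not depend on the input).
   The transcript is the sequence of bits sent; the leaf reached holds the
   output, so the output is a function of the transcript. *)
Inductive protocol (R X Y : Type) :=
| Leaf of bool
| ANode of (X -> R) & protocol R X Y & protocol R X Y
| BNode of (Y -> R) & protocol R X Y & protocol R X Y.
Arguments Leaf {R X Y}.
Arguments ANode {R X Y}.
Arguments BNode {R X Y}.

Fixpoint wf_prot {R : realType} {X Y : Type} (P : protocol R X Y) : Prop :=
  match P with
  | Leaf _ => True
  | ANode p c0 c1 => (forall x, 0 <= p x <= 1) /\ wf_prot c0 /\ wf_prot c1
  | BNode p c0 c1 => (forall y, 0 <= p y <= 1) /\ wf_prot c0 /\ wf_prot c1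
  end.

Fixpoint leaves {R X Y : Type} (P : protocol R X Y) : seq (seq bool) :=
  match P with
  | Leaf _ => [:: [::]]
  | ANode _ c0 c1 => map (cons false) (leaves c0) ++ map (cons true) (leaves c1)
  | BNode _ c0 c1 => map (cons false) (leaves c0) ++ map (cons true) (leaves c1)
  end.

Fixpoint tprob {R : realType} {X Y : Type} (P : protocol R X Y) (x : X) (y : Y)
  (t : seq bool) : R :=
  match P, t with
  | Leaf _, [::] => 1
  | ANode p c0 c1, b :: t' =>
      if b then p x * tprob c1 x y t' else (1 - p x) * tprob c0 x y t'
  | BNode p c0 c1, b :: t' =>
      if b then p y * tprob c1 x y t' else (1 - p y) * tprob c0 x y t'
  | _, _ => 0
  end.

Fixpoint output {R X Y : Type} (P : protocol R X Y) (t : seq bool) : bool :=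
  match P, t with
  | Leaf b, _ => b
  | ANode _ c0 c1, b :: t' => if b then output c1 t' else output c0 t'
  | BNode _ c0 c1, b :: t' => if b then output c1 t' else output c0 t'
  | _, [::] => false
  end.

Definition tmarg {R : realType} {X Y : finType} (mu : X * Y -> R)
  (P : protocol R X Y) (t : seq bool) : R :=
  \sum_z mu z * tprob P z.1 z.2 t.

(* External information I(Pi(X,Y) ; X,Y) with (X,Y) ~ mu, base-2 logs,
   convention 0 log 0 = 0. *)
Definition ext_info {R : realType} {X Y : finType} (mu : X * Y -> R)
  (P : protocol R X Y) : R :=
  \sum_(t <- leaves P) \sum_z
     (let q := mu z * tprob P z.1 z.2 t in
      if q == 0 then 0 else q * log2 (tprob P z.1 z.2 t / tmarg mu P t)).

Definition success {R : realType} {X Y : finType} (mu : X * Y -> R)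
  (f : X * Y -> bool) (P : protocol R X Y) : R :=
  \sum_z mu z * \sum_(t <- leaves P) tprob P z.1 z.2 t * (output P t == f z)%:R.

Definition rect_meas {R : realType} {X Y : finType} (rho : X * Y -> R)
  (A : {set X}) (B : {set Y}) : R :=
  \sum_(z | (z.1 \in A) && (z.2 \in B)) rho z.

Definition rect_meas_val {R : realType} {X Y : finType} (mu : X * Y -> R)
  (f : X * Y -> bool) (b : bool) (A : {set X}) (B : {set Y}) : R :=
  \sum_(z | [&& z.1 \in A, z.2 \in B & f z == b]) mu z.

Definition rel_disc_wrt {R : realType} {X Y : finType} (f : X * Y -> bool)
  (mu : X * Y -> R) (eps delta : R) (rho : X * Y -> R) : Prop :=
  forall (A : {set X}) (B : {set Y}), rect_meas rho A B >= delta ->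
    rect_meas_val mu f false A B >= (2^-1 - eps) * rect_meas rho A B /\
    rect_meas_val mu f true A B >= (2^-1 - eps) * rect_meas rho A B.

Definition rel_disc {R : realType} {X Y : finType} (f : X * Y -> bool)
  (mu : X * Y -> R) (eps delta : R) : Prop :=
  exists rho : X * Y -> R, is_dist rho /\ rel_disc_wrt f mu eps delta rho.

(* Main.v *)
(* The transcript law factors as a_t(x) b_t(y), and its mu-average as
   r_t = rA_t rB_t, where rA, rB are the strategies in which each player sends
   the mu-conditional mean bit. For fixed (x, y), the divergence of a_t b_t from
   r_t is the sum of the divergences from rA_t b_t and from a_t rB_t. The
   transcripts along which a exceeds C rA at some prefix have mass at most 1/C
   under rA_t b_t, so their true mass is at most divergence / (ln C - 1);
   averaged over mu, overshooting has probability O(I / ln C). Clamping both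
   strategies so that a' <= C rA and b' <= C rB therefore changes the success
   probability little. For each t, the function a'_t(x) b'_t(y) is C^2 r_t times
   a convex combination of rectangles, so relative discrepancy applies with a
   loss of delta C^2 r_t, which sums to delta C^2; C = delta^(-1/4) balances the
   two errors. When I = 0 the transcript law is r and no clamping is needed. *)
Require Import Defs.
From HB Require Import structures.
From mathcomp Require Import all_boot all_order all_algebra.
From mathcomp Require Import reals exp.
From mathcomp Require Import sequences ring lra.
Import Order.TTheory GRing.Theory Num.Theory.
Local Open Scope ring_scope.

Set Implicit Arguments.
Unset Strict Implicit.
Unset Printing Implicit Defensive.

(** * Strategies on protocol trees *)

(** The skeleton of a protocol, each node labelled by its owner; sending probabilities are kept
    apart in strategies so that one player's can be replaced. *)
Inductive tree := TLeaf | TNode of bool & tree & tree.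

Fixpoint tleaves (T : tree) : seq (seq bool) :=
  match T with
  | TLeaf => [:: [::]]
  | TNode _ c0 c1 => map (cons false) (tleaves c0) ++ map (cons true) (tleaves c1)
  end.

Definition bitp {R : realType} (b : bool) (p : R) : R := if b then p else 1 - p.

Definition shift {R : Type} (b : bool) (st : seq bool -> R) : seq bool -> R :=
  fun v => st (b :: v).

Definition glue {R : Type} (q : R) (st0 st1 : seq bool -> R) (v : seq bool) : R :=
  match v with
  | [::] => q
  | b :: v' => if b then st1 v' else st0 v'
  end.

Definition unit_strategy {R : realType} (st : seq bool -> R) : Prop :=
  forall v, 0 <= st v <= 1.

(* A strategy [st] gives the probability of sending bit 1 at each prefix;
   [sval s T st t] is the product of the factors of the transcript [t]
   contributed at the nodes owned by player [s] (true: Alice, false: Bob). *)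
Fixpoint sval {R : realType} (s : bool) (T : tree) (st : seq bool -> R)
    (t : seq bool) : R :=
  match T, t with
  | TLeaf, [::] => 1
  | TNode o c0 c1, b :: t' =>
      (if o == s then bitp b (st [::]) else 1) *
      sval s (if b then c1 else c0) (shift b st) t'
  | _, _ => 0
  end.

Lemma bitp_ge0 (R : realType) b (p : R) : 0 <= p <= 1 -> 0 <= bitp b p.
Proof. by case/andP => p0 p1; case: b => //=; rewrite subr_ge0. Qed.

Lemma unit_shift (R : realType) b (st : seq bool -> R) :
  unit_strategy st -> unit_strategy (shift b st).
Proof. by move=> st01 v; exact: st01. Qed.

Lemma sum_tleaves_node (R : realType) o c0 c1 (F : seq bool -> R) :
  \sum_(t <- tleaves (TNode o c0 c1)) F t =
  \sum_(t <- tleaves c0) F (false :: t) + \sum_(t <- tleaves c1) F (true :: t).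
Proof. by rewrite /= big_cat !big_map. Qed.

Lemma sval_ge0 (R : realType) s T (st : seq bool -> R) t :
  unit_strategy st -> 0 <= sval s T st t.
Proof.
elim: T st t => [|o c0 IH0 c1 IH1] st [|b t] st01 //=.
apply: mulr_ge0; first by case: ifP => // _; apply/bitp_ge0/st01.
by case: b; [apply: IH1 | apply: IH0]; exact: unit_shift.
Qed.

(** Each node has one owner, so exactly one of the two strategies supplies its bit and the two bit
    probabilities add up to 1. Mixed pairs, one true strategy against one reference, are thus also
    normalised. *)
Lemma sum_sval (R : realType) s T (st tau : seq bool -> R) :
  \sum_(t <- tleaves T) sval s T st t * sval (~~ s) T tau t = 1.
Proof.
elim: T st tau => [|o c0 IH0 c1 IH1] st tau; first by rewrite big_seq1 /= mulr1.
rewrite sum_tleaves_node /=.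
under eq_bigr => t _ do rewrite mulrACA.
under [X in _ + X]eq_bigr => t _ do rewrite mulrACA.
rewrite -!mulr_sumr IH0 IH1 /=.
have -> : (o == ~~ s) = ~~ (o == s) by case: (o); case: (s).
by case: (o == s) => /=; ring.
Qed.

(** * Overshooting a reference strategy, and clamping *)

(** [a] and [r] accumulate the products of [st] and [ref] along the prefix read so far. *)
Fixpoint crosses {R : realType} (s : bool) (C : R) (T : tree)
    (st ref : seq bool -> R) (a r : R) (t : seq bool) : bool :=
  (C * r < a) ||
  match T, t with
  | TNode o c0 c1, b :: t' =>
      crosses s C (if b then c1 else c0) (shift b st) (shift b ref)
        (a * (if o == s then bitp b (st [::]) else 1))
        (r * (if o == s then bitp b (ref [::]) else 1)) t'
  | _, _ => false
  end.

Lemma clamp_bit (R : realType) (k p pr : R) :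
  1 <= k -> 0 <= p <= 1 -> 0 <= pr <= 1 ->
  exists q, [/\ 0 <= q <= 1, forall b, bitp b q <= k * bitp b pr &
    forall b, Num.min (bitp b p) (k * bitp b pr) <= bitp b q].
Proof.
move=> k1 /andP[p0 p1] /andP[r0 r1].
have hk : pr <= k * pr by rewrite ler_peMl.
have lk : 1 - pr <= k * (1 - pr) by rewrite ler_peMl // subr_ge0.
(* Clamp [p] to the interval from [1 - k * (1 - pr)] to [k * pr], nonempty because [1 <= k]; its
   ends are the caps for bit 0 and bit 1. *)
exists (Num.max (1 - k * (1 - pr)) (Num.min p (k * pr))); split.
- rewrite le_max le_min p0 (le_trans r0 hk) orbT /=.
  by rewrite ge_max ge_min p1 /= andbT; lra.
- case=> /=; first by rewrite ge_max ge_min lexx orbT andbT; lra.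
  by rewrite lerBlDl -lerBlDr le_max lexx.
- case=> /=; first by rewrite le_max lexx orbT.
  rewrite lerBrDr -lerBrDl ge_max; apply/andP; split.
    by rewrite lerD2l lerN2 ge_min lexx orbT.
  rewrite lerBrDl -lerBrDr ge_min; apply/orP; left.
  by rewrite lerD2l lerN2 ge_min lexx.
Qed.

Lemma clamp_scaled (R : realType) (K a p pr : R) :
  0 <= a <= K -> 0 <= p <= 1 -> 0 <= pr <= 1 ->
  exists q, [/\ 0 <= q <= 1, forall b, a * bitp b q <= K * bitp b pr &
    forall b, Num.min (a * bitp b p) (K * bitp b pr) <= a * bitp b q].
Proof.
move=> /andP[a0 aK] p01 r01; move: a0; rewrite le0r => /orP[/eqP a0|a0].
  exists p; split=> // b; rewrite a0 ?mul0r.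
    by rewrite mulr_ge0 ?bitp_ge0 // -a0.
  by rewrite ge_min lexx.
have k1 : 1 <= K / a by rewrite ler_pdivlMr // mul1r.
have [q [q01 qle qge]] := clamp_bit k1 p01 r01; exists q; split=> // b.
  by rewrite mulrC -ler_pdivlMr // mulrAC qle.
have := qge b; rewrite -(ler_pM2l a0) minr_pMr ?(ltW a0) //.
by rewrite mulrA (mulrC a (K / a)) divfK // gt_eqF.
Qed.

(* While [st] has not overshot [C] times the reference, the clamped strategy
   is at least as likely as [st] to follow the transcript: the mass clamped
   away from one bit goes to the other. *)
Lemma clamped_strategy (R : realType) s T (C a r : R) (st ref : seq bool -> R) :
  0 <= C -> 0 <= r -> 0 <= a <= C * r -> unit_strategy st -> unit_strategy ref ->
  exists st', [/\ unit_strategy st',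
    forall t, a * sval s T st' t <= C * (r * sval s T ref t) &
    forall a0 t, 0 <= a0 <= a -> ~~ crosses s C T st ref a0 r t ->
      a0 * sval s T st t <= a * sval s T st' t].
Proof.
(* The induction keeps two products: [a] for the clamped strategy and [a0 <= a] for the original
   one, as the clamped one may have gained mass higher up. *)
move=> C0; elim: T a r st ref => [|o c0 IH0 c1 IH1] a r st ref r0
  /andP[a0 aC] st01 ref01.
  exists st; split=> //.
    by case=> [|b t] /=; rewrite ?mulr1 // !mulr0.
  by move=> a1 [|b t] /andP[a10 a1a] _ /=; rewrite ?mulr1 // !mulr0.
have [q [q01 qle qge]] : exists q, [/\ 0 <= q <= 1,
    forall b, a * (if o == s then bitp b q else 1) <=
              C * (r * (if o == s then bitp b (ref [::]) else 1)) &
    forall b, Num.min (a * (if o == s then bitp b (st [::]) else 1))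
                (C * (r * (if o == s then bitp b (ref [::]) else 1)))
              <= a * (if o == s then bitp b q else 1)].
  case: (o == s); last first.
    by exists 0; split=> [|_|_]; rewrite ?lexx ?ler01 ?mulr1 // ge_min lexx.
  have [|q [q01 qle qge]] := @clamp_scaled R (C * r) a (st [::]) (ref [::])
    _ (st01 _) (ref01 _); first by rewrite a0.
  by exists q; split=> // b; rewrite mulrA.
set x := fun b => if o == s then bitp b q else 1.
set xr := fun b => if o == s then bitp b (ref [::]) else 1.
have x0 b : 0 <= x b by rewrite /x; case: ifP => // _; exact: bitp_ge0.
have xr0 b : 0 <= xr b by rewrite /xr; case: ifP => // _; exact/bitp_ge0/ref01.
have step b : 0 <= a * x b <= C * (r * xr b) by rewrite qle mulr_ge0.
have [st0 [u0 le0 ge0]] := IH0 _ _ _ _ (mulr_ge0 r0 (xr0 false)) (step false)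
  (unit_shift false st01) (unit_shift false ref01).
have [st1 [u1 le1 ge1]] := IH1 _ _ _ _ (mulr_ge0 r0 (xr0 true)) (step true)
  (unit_shift true st01) (unit_shift true ref01).
exists (glue q st0 st1); split.
- by case=> [|[] v] //=.
- case=> [|b t] /=; first by rewrite !mulr0.
  by rewrite !mulrA -!(mulrA C); case: b; [exact: le1 | exact: le0].
move=> a1 [|b t] /andP[a10 a1a]; first by rewrite /= !mulr0.
rewrite /= negb_or !mulrA => /andP[_ nc].
set y := (if o == s then bitp b (st [::]) else 1) in nc *.
have y0 : 0 <= y by rewrite /y; case: ifP => // _; exact/bitp_ge0/st01.
(* The child prefix has not overshot, so [a1 * y] is below both arguments of the minimum in
   [qge]. *)
have ay : 0 <= a1 * y <= a * x b.
  rewrite mulr_ge0 //= (le_trans _ (qge b)) // le_min ler_wpM2r //=.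
  by move: nc; case: (if b then c1 else c0) => [|? ? ?] /=;
     rewrite negb_or -leNgt => /andP[].
by case: b y nc y0 ay => y nc y0 ay; [exact: ge1 | exact: ge0].
Qed.

(** Group the crossing transcripts by their first crossing prefix. There the [st] product exceeds
    [C] times the [ref] product, the factor from [tau] is common, and the subtree below has total
    mass 1 under either pair. *)
Lemma crosses_mass (R : realType) s (C : R) T (st ref tau : seq bool -> R) a r :
  unit_strategy st -> unit_strategy ref -> unit_strategy tau ->
  C * (r * \sum_(t <- tleaves T | crosses s C T st ref a r t)
         sval s T ref t * sval (~~ s) T tau t) <=
  a * \sum_(t <- tleaves T | crosses s C T st ref a r t)
         sval s T st t * sval (~~ s) T tau t.
Proof.
elim: T a r st ref tau => [|o c0 IH0 c1 IH1] a r st ref tau st01 ref01 tau01.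
  rewrite !big_mkcond !big_seq1 /= orbF mulr1.
  by case: ifPn => [/ltW|_]; rewrite ?mulr1 ?mulr0.
case: (ltP (C * r) a) => [Cra|Cra].
  have all_cross t : crosses s C (TNode o c0 c1) st ref a r t by rewrite /= Cra.
  rewrite (eq_bigl xpredT) // [X in _ <= a * X](eq_bigl xpredT) //.
  by rewrite !sum_sval !mulr1 ltW.
rewrite !(big_mkcond (crosses _ _ _ _ _ _ _)) !sum_tleaves_node /= ltNge Cra /=.
have wpull (c : seq bool -> bool) (f g : seq bool -> R) T (u v : R) :
    \sum_(t <- tleaves T) (if c t then u * f t * (v * g t) else 0) =
    v * (u * \sum_(t <- tleaves T | c t) f t * g t).
  rewrite [in RHS]big_mkcond !mulr_sumr; apply: eq_bigr => t _.
  by case: (c t); ring.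
rewrite !wpull // !mulrDr.
have pass (X Y w u v : R) : 0 <= w -> C * (r * u * X) <= a * v * Y ->
    C * (r * (w * (u * X))) <= a * (w * (v * Y)).
  move=> w0 le; rewrite (_ : C * _ = w * (C * (r * u * X))); last by ring.
  by rewrite (_ : a * _ = w * (a * v * Y)) ?ler_wpM2l //; ring.
have w0 b : 0 <= (if o == ~~ s then bitp b (tau [::]) else 1).
  by case: ifP => // _; exact/bitp_ge0/tau01.
apply: lerD; apply: pass; [exact: (w0 false) | apply: IH0; exact: unit_shift
                          | exact: (w0 true) | apply: IH1; exact: unit_shift].
Qed.

(** * Factorization of transcript laws *)

Fixpoint shape {R X Y : Type} (P : protocol R X Y) : tree :=
  match P with
  | Leaf _ => TLeaf
  | ANode _ c0 c1 => TNode true (shape c0) (shape c1)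
  | BNode _ c0 c1 => TNode false (shape c0) (shape c1)
  end.

(** The value 0 at Bob's nodes and off the tree is junk: [sval true] reads only nodes owned by
    Alice. *)
Fixpoint alice {R : realType} {X Y : Type} (P : protocol R X Y) (x : X)
    (v : seq bool) : R :=
  match P, v with
  | ANode p _ _, [::] => p x
  | ANode _ c0 c1, b :: v' => alice (if b then c1 else c0) x v'
  | BNode _ c0 c1, b :: v' => alice (if b then c1 else c0) x v'
  | _, _ => 0
  end.

Fixpoint bob {R : realType} {X Y : Type} (P : protocol R X Y) (y : Y)
    (v : seq bool) : R :=
  match P, v with
  | BNode p _ _, [::] => p y
  | ANode _ c0 c1, b :: v' => bob (if b then c1 else c0) y v'
  | BNode _ c0 c1, b :: v' => bob (if b then c1 else c0) y v'
  | _, _ => 0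
  end.

(* At each prefix, the conditional probability of the bit 1 when the input has
   law proportional to [w] (junk value 0 at unreachable prefixes). *)
Fixpoint mean_strategy {R : realType} {X Y : finType} (w : X * Y -> R)
    (P : protocol R X Y) (v : seq bool) : R :=
  match P, v with
  | Leaf _, _ => 0
  | ANode p _ _, [::] => (\sum_z w z * p z.1) / \sum_z w z
  | BNode p _ _, [::] => (\sum_z w z * p z.2) / \sum_z w z
  | ANode p c0 c1, b :: v' =>
      mean_strategy (fun z => w z * bitp b (p z.1)) (if b then c1 else c0) v'
  | BNode p c0 c1, b :: v' =>
      mean_strategy (fun z => w z * bitp b (p z.2)) (if b then c1 else c0) v'
  end.

Lemma leaves_shape (R X Y : Type) (P : protocol R X Y) :
  leaves P = tleaves (shape P).
Proof. by elim: P => //= _ c0 -> c1 ->. Qed.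

Lemma tprob_sval (R : realType) (X Y : Type) (P : protocol R X Y) x y t :
  tprob P x y t =
  sval true (shape P) (alice P x) t * sval false (shape P) (bob P y) t.
Proof.
elim: P t => [o|p c0 IH0 c1 IH1|p c0 IH0 c1 IH1] [|b t] //=;
  rewrite ?mulr1 ?mul0r //.
- by rewrite mul1r -mulrA; case: b => /=; rewrite ?IH0 ?IH1.
- by rewrite mul1r mulrCA; case: b => /=; rewrite ?IH0 ?IH1.
Qed.

Lemma unit_alice (R : realType) (X Y : Type) (P : protocol R X Y) x :
  wf_prot P -> unit_strategy (alice P x).
Proof.
elim: P => [o _|p c0 IH0 c1 IH1 /= [p01 [w0 w1]]|p c0 IH0 c1 IH1 /= [p01 [w0 w1]]].
- by move=> v; rewrite /= lexx ler01.
- by case=> [|[] v] /=; [exact: p01 | exact: IH1 | exact: IH0].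
- by case=> [|[] v] /=; [rewrite lexx ler01 | exact: IH1 | exact: IH0].
Qed.

Lemma unit_bob (R : realType) (X Y : Type) (P : protocol R X Y) y :
  wf_prot P -> unit_strategy (bob P y).
Proof.
elim: P => [o _|p c0 IH0 c1 IH1 /= [p01 [w0 w1]]|p c0 IH0 c1 IH1 /= [p01 [w0 w1]]].
- by move=> v; rewrite /= lexx ler01.
- by case=> [|[] v] /=; [rewrite lexx ler01 | exact: IH1 | exact: IH0].
- by case=> [|[] v] /=; [exact: p01 | exact: IH1 | exact: IH0].
Qed.

Lemma mean_unit (R : realType) (I : finType) (w p : I -> R) :
  (forall z, 0 <= w z) -> (forall z, 0 <= p z <= 1) ->
  0 <= (\sum_z w z * p z) / \sum_z w z <= 1.
Proof.
move=> w0 p01; have s0 : 0 <= \sum_z w z by exact: sumr_ge0.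
have n0 : 0 <= \sum_z w z * p z.
  by apply: sumr_ge0 => z _; case/andP: (p01 z) => p0 _; exact: mulr_ge0.
rewrite divr_ge0 //=; move: s0; rewrite le0r => /orP[/eqP ->|s0].
  by rewrite invr0 mulr0 ler01.
rewrite ler_pdivrMr // mul1r; apply: ler_sum => z _.
by case/andP: (p01 z) => _ p1; exact: ler_piMr.
Qed.

(** If the total weight is 0 then every [w z] is 0, so the junk quotient is harmless. *)
Lemma bitp_mean (R : realType) (I : finType) (w p : I -> R) b :
  (forall z, 0 <= w z) ->
  (\sum_z w z) * bitp b ((\sum_z w z * p z) / \sum_z w z) =
  \sum_z w z * bitp b (p z).
Proof.
move=> w0; have [s0|s0] := eqVneq (\sum_z w z) 0.
  have wz z : w z = 0 by apply: (psumr_eq0P _ s0).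
  by rewrite s0 mul0r big1 // => z _; rewrite wz mul0r.
case: b => /=; first by rewrite mulrC divfK.
rewrite mulrBr mulr1 mulrC divfK // -sumrB.
by apply: eq_bigr => z _; rewrite mulrBr mulr1.
Qed.

Lemma unit_mean_strategy (R : realType) (X Y : finType) (P : protocol R X Y)
    (w : X * Y -> R) :
  wf_prot P -> (forall z, 0 <= w z) -> unit_strategy (mean_strategy w P).
Proof.
elim: P w => [o|p c0 IH0 c1 IH1|p c0 IH0 c1 IH1] w /=.
- by move=> _ _ v; rewrite lexx ler01.
- move=> [p01 [w0 w1]] wge; case=> [|b v].
    exact: (@mean_unit R _ w (fun z => p z.1)).
  by case: b; [apply: IH1 | apply: IH0] => // z; rewrite mulr_ge0 // bitp_ge0.
- move=> [p01 [w0 w1]] wge; case=> [|b v].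
    exact: (@mean_unit R _ w (fun z => p z.2)).
  by case: b; [apply: IH1 | apply: IH0] => // z; rewrite mulr_ge0 // bitp_ge0.
Qed.

(** Chain rule: multiplying the total weight by the mean bit gives the total of the reweighted [w]
    passed to the child. Hence the averaged transcript law is itself a product of two strategies. *)
Lemma mean_strategy_tmarg (R : realType) (X Y : finType) (P : protocol R X Y)
    (w : X * Y -> R) t :
  wf_prot P -> (forall z, 0 <= w z) ->
  (\sum_z w z) * (sval true (shape P) (mean_strategy w P) t *
                  sval false (shape P) (mean_strategy w P) t) = tmarg w P t.
Proof.
rewrite /tmarg; elim: P w t => [o|p c0 IH0 c1 IH1|p c0 IH0 c1 IH1] w [|b t] wfP wge.
1: by rewrite /= !mulr1; apply: eq_bigr => z _; rewrite mulr1.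
1,2,4: by rewrite /= !mulr0 big1 // => z _; rewrite mulr0.
- rewrite [RHS](eq_bigr (fun z => w z * bitp b (p z.1) *
    tprob (if b then c1 else c0) z.1 z.2 t)); last first.
    by move=> z _; rewrite -mulrA; case: (b).
  case: wfP => p01 [wf0 wf1]; rewrite /= mul1r -mulrA mulrA.
  rewrite (@bitp_mean R _ w (fun z => p z.1)) //.
  have w'ge z : 0 <= w z * bitp b (p z.1) by rewrite mulr_ge0 // bitp_ge0.
  by case: b w'ge => w'ge; [exact: IH1 | exact: IH0].
- rewrite [RHS](eq_bigr (fun z => w z * bitp b (p z.2) *
    tprob (if b then c1 else c0) z.1 z.2 t)); last first.
    by move=> z _; rewrite -mulrA; case: (b).
  case: wfP => p01 [wf0 wf1].
  rewrite /= mul1r (mulrCA (sval _ _ _ _)) [LHS]mulrA.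
  rewrite (@bitp_mean R _ w (fun z => p z.2)) //.
  have w'ge z : 0 <= w z * bitp b (p z.2) by rewrite mulr_ge0 // bitp_ge0.
  by case: b w'ge => w'ge; [exact: IH1 | exact: IH0].
Qed.

(** * Divergence bounds *)

(** This is [ln u <= u - 1] at [u = s * q / p], multiplied by [p]. *)
Lemma kl_term (R : realType) (s p q : R) :
  0 < s -> 0 <= p -> 0 <= q -> (q = 0 -> p = 0) ->
  p * ln s + p - s * q <= p * ln (p / q).
Proof.
move=> s0; rewrite le0r => /orP[/eqP -> q0 _|p0 q0 qp].
  by rewrite !mul0r !add0r oppr_le0 mulr_ge0 // ltW.
have {}q0 : 0 < q.
  by rewrite lt0r q0 andbT; apply/eqP => /qp p_0; rewrite p_0 ltxx in p0.
have u0 : 0 < s * q / p by rewrite divr_gt0 // mulr_gt0.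
have u1 : -1 < s * q / p - 1 by lra.
have := le_ln1Dx u1; rewrite (addrC 1) subrK -(ler_pM2l p0).
rewrite mulrBr mulr1 mulrCA divff ?gt_eqF // mulr1.
have -> : s * q / p = s / (p / q) by rewrite invf_div mulrA.
by rewrite ln_div ?posrE ?divr_gt0 // mulrBr; lra.
Qed.

(** The variational bound on divergence with a two-valued test function: [kl_term] with factor [s]
    on [E] and factor 1 off [E]. *)
Lemma kl_event (R : realType) (T : Type) (l : seq T) (p q : T -> R)
    (E : pred T) (s : R) :
  0 < s -> (forall t, 0 <= p t) -> (forall t, 0 <= q t) ->
  (forall t, q t = 0 -> p t = 0) ->
  \sum_(t <- l) p t = 1 -> \sum_(t <- l) q t = 1 ->
  (\sum_(t <- l | E t) p t) * ln s - (s - 1) * \sum_(t <- l | E t) q t <=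
  \sum_(t <- l) p t * ln (p t / q t).
Proof.
move=> s0 p0 q0 qp sp sq.
rewrite [leRHS](bigID E) /=.
have leE : (\sum_(t <- l | E t) p t) * ln s + \sum_(t <- l | E t) p t
    - s * (\sum_(t <- l | E t) q t) <= \sum_(t <- l | E t) p t * ln (p t / q t).
  rewrite mulr_suml mulr_sumr -big_split -sumrB /=.
  by apply: ler_sum => t _; apply: kl_term => //; exact: qp.
have leN : \sum_(t <- l | ~~ E t) p t - \sum_(t <- l | ~~ E t) q t <=
    \sum_(t <- l | ~~ E t) p t * ln (p t / q t).
  rewrite -sumrB; apply: ler_sum => t _.
  by have := kl_term ltr01 (p0 t) (q0 t) (@qp t); rewrite ln1 mulr0 add0r mul1r.
move: sp sq; rewrite (bigID E) /= => sp; rewrite (bigID E) /= => sq.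
lra.
Qed.

(** The logarithm splits as [ln (a / ra) + ln (b / rb)], and [kl_event] with [s = C] bounds each
    part. The subtracted term is at most the true mass of the event, which costs the 1 in
    [ln C - 1]. *)
Lemma kl_product (R : realType) (T : Type) (l : seq T) (a b ra rb : T -> R)
    (A B : pred T) (C : R) :
  1 <= C -> (forall t, 0 <= a t) -> (forall t, 0 <= b t) ->
  (forall t, 0 <= ra t) -> (forall t, 0 <= rb t) ->
  (forall t, ra t * rb t = 0 -> a t * b t = 0) ->
  \sum_(t <- l) a t * b t = 1 -> \sum_(t <- l) ra t * b t = 1 ->
  \sum_(t <- l) rb t * a t = 1 ->
  C * \sum_(t <- l | A t) ra t * b t <= \sum_(t <- l | A t) a t * b t ->
  C * \sum_(t <- l | B t) rb t * a t <= \sum_(t <- l | B t) a t * b t ->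
  (\sum_(t <- l | A t) a t * b t + \sum_(t <- l | B t) a t * b t) * (ln C - 1) <=
  \sum_(t <- l) a t * b t * ln (a t * b t / (ra t * rb t)).
Proof.
move=> C1 a0 b0 ra0 rb0 ac sab srb sar CA CB; have C0 : 0 < C by exact: lt_le_trans C1.
have ab0 t : 0 <= a t * b t by exact: mulr_ge0.
have rab0 t : 0 <= ra t * b t by exact: mulr_ge0.
have arb0 t : 0 <= rb t * a t by exact: mulr_ge0.
have qa t : ra t * b t = 0 -> a t * b t = 0.
  move=> /eqP; rewrite mulf_eq0 => /orP[/eqP r|/eqP ->]; last by rewrite mulr0.
  by apply: ac; rewrite r mul0r.
have qb t : rb t * a t = 0 -> a t * b t = 0.
  move=> /eqP; rewrite mulf_eq0 => /orP[/eqP r|/eqP ->]; last by rewrite mul0r.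
  by apply: ac; rewrite r mulr0.
have klA := kl_event A C0 ab0 rab0 qa sab srb.
have klB := kl_event B C0 ab0 arb0 qb sab sar.
have -> : \sum_(t <- l) a t * b t * ln (a t * b t / (ra t * rb t)) =
    \sum_(t <- l) a t * b t * ln (a t * b t / (ra t * b t)) +
    \sum_(t <- l) a t * b t * ln (a t * b t / (rb t * a t)).
  rewrite -big_split; apply: eq_bigr => t _ /=; rewrite -mulrDr.
  have [->|abn] := eqVneq (a t * b t) 0; first by rewrite !mul0r.
  have := ac t; move: abn; rewrite mulf_eq0 negb_or => /andP[an bn] abr.
  have rn : ra t * rb t != 0.
    by apply/eqP => /abr; apply/eqP; rewrite mulf_neq0.
  move: rn; rewrite mulf_eq0 negb_or => /andP[ran rbn].
  rewrite -lnM ?posrE; last 2 first.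
  - by apply: divr_gt0; rewrite lt0r mulf_neq0 /=.
  - by apply: divr_gt0; rewrite lt0r mulf_neq0 /=.
  by congr (_ * ln _); field; rewrite an bn ran rbn.
have sA0 : 0 <= \sum_(t <- l | A t) ra t * b t by exact: sumr_ge0.
have sB0 : 0 <= \sum_(t <- l | B t) rb t * a t by exact: sumr_ge0.
lra.
Qed.

(** * From rectangles to product functions *)

(** A linear form on a box is least when [g] is [U] at negative coefficients and 0 elsewhere. *)
Lemma sum_lt0_le (R : realType) (I : finType) (G g : I -> R) (U : R) :
  (forall i, 0 <= g i <= U) ->
  U * \sum_(i | G i < 0) G i <= \sum_i g i * G i.
Proof.
move=> gU; rewrite big_mkcond mulr_sumr; apply: ler_sum => i _.
case/andP: (gU i) => g0 gi; case: ltP => Gi; last by rewrite mulr0 mulr_ge0.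
by rewrite ler_wnM2r // ltW.
Qed.

(* A bilinear form on a product of boxes is minimal at a vertex, that is, at a
   rectangle. *)
Lemma rectangles_to_products (R : realType) (X Y : finType) (w : X * Y -> R)
    (k U V : R) (g : X -> R) (h : Y -> R) :
  0 <= U -> 0 <= V ->
  (forall (A : {set X}) (B : {set Y}),
     - k <= \sum_(z | (z.1 \in A) && (z.2 \in B)) w z) ->
  (forall x, 0 <= g x <= U) -> (forall y, 0 <= h y <= V) ->
  - (k * (U * V)) <= \sum_z w z * (g z.1 * h z.2).
Proof.
move=> U0 V0 rect gU hV.
(* Minimise over [g] first, giving [A]; what remains is linear in [h] with coefficients [H], giving
   [B]. *)
pose G x := \sum_y w (x, y) * h y.
pose A := [set x | G x < 0].
pose H y := \sum_(x in A) w (x, y).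
pose B := [set y | H y < 0].
have -> : \sum_z w z * (g z.1 * h z.2) = \sum_x g x * G x.
  rewrite [RHS](eq_bigr (fun x => \sum_y w (x, y) * (g x * h y))); last first.
    by move=> x _; rewrite mulr_sumr; apply: eq_bigr => y _; rewrite mulrCA.
  by rewrite pair_bigA /=; apply: eq_bigr => -[].
apply: le_trans (sum_lt0_le G gU).
have -> : \sum_(x | G x < 0) G x = \sum_y h y * H y.
  rewrite (eq_bigl (mem A)); last by move=> x; rewrite !inE.
  rewrite exchange_big; apply: eq_bigr => y _; rewrite mulr_sumr.
  by apply: eq_bigr => x _; rewrite mulrC.
apply: le_trans (ler_wpM2l U0 (sum_lt0_le H hV)).
have -> : \sum_(y | H y < 0) H y = \sum_(z | (z.1 \in A) && (z.2 \in B)) w z.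
  rewrite (eq_bigl (mem B)); last by move=> y; rewrite !inE.
  by rewrite exchange_big pair_big /=; apply: eq_bigr => -[].
by have := ler_wpM2l (mulr_ge0 U0 V0) (rect A B); rewrite mulrN mulrC -(mulrA U).
Qed.

Lemma rel_disc_product (R : realType) (X Y : finType) (f : X * Y -> bool)
    (mu rho : X * Y -> R) (eps delta U V : R) (b : bool) (g : X -> R) (h : Y -> R) :
  0 <= delta -> eps <= 2^-1 -> (forall z, 0 <= mu z) ->
  rel_disc_wrt f mu eps delta rho -> 0 <= U -> 0 <= V ->
  (forall x, 0 <= g x <= U) -> (forall y, 0 <= h y <= V) ->
  (2^-1 - eps) * (\sum_z rho z * (g z.1 * h z.2) - delta * (U * V)) <=
  \sum_z mu z * (g z.1 * h z.2) * (f z == b)%:R.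
Proof.
move=> d0 e2 mu0 disc U0 V0 gU hV; have e0 : 0 <= 2^-1 - eps by rewrite subr_ge0.
(* This signed weight is nonnegative on rectangles with [rho] mass at least [delta]; on lighter ones
   its negative part is at most [(2^-1 - eps) * delta]. *)
pose w z := mu z * (f z == b)%:R - (2^-1 - eps) * rho z.
have rect (A : {set X}) (B : {set Y}) :
    - ((2^-1 - eps) * delta) <= \sum_(z | (z.1 \in A) && (z.2 \in B)) w z.
  rewrite sumrB -mulr_sumr -/(rect_meas rho A B).
  have -> : \sum_(z | (z.1 \in A) && (z.2 \in B)) mu z * (f z == b)%:R =
            rect_meas_val mu f b A B.
    rewrite /rect_meas_val [RHS](eq_bigl (fun z => ((z.1 \in A) && (z.2 \in B))
      && (f z == b))); last by move=> z; rewrite andbA.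
    by rewrite [RHS]big_mkcondr /=; apply: eq_bigr => z _;
      case: (f z == b); rewrite ?mulr1 ?mulr0.
  have [dR|/ltW dR] := leP delta (rect_meas rho A B).
    have := mulr_ge0 e0 d0.
    by case: (disc A B dR); case: (b) => ? ?; lra.
  have : 0 <= rect_meas_val mu f b A B by apply: sumr_ge0.
  by have := ler_wpM2l e0 dR; lra.
have := rectangles_to_products U0 V0 rect gU hV.
rewrite (eq_bigr (fun z => mu z * (g z.1 * h z.2) * (f z == b)%:R -
   (2^-1 - eps) * (rho z * (g z.1 * h z.2)))); last by move=> z _; rewrite /w; ring.
rewrite sumrB -mulr_sumr mulrBr; lra.
Qed.

(** Bound the error probability from below, transcript by transcript, with [U = C * ra t] and
    [V = C * rb t]. The losses [delta * U * V] sum to [delta * C ^+ 2]. *)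
Lemma bounded_success (R : realType) (X Y : finType) (T : eqType) (l : seq T)
    (out : T -> bool) (f : X * Y -> bool) (mu rho : X * Y -> R)
    (eps delta C : R) (al : X -> T -> R) (be : Y -> T -> R) (ra rb : T -> R) :
  0 <= delta -> 0 <= eps <= 2^-1 -> 0 <= C -> is_dist mu -> is_dist rho ->
  rel_disc_wrt f mu eps delta rho ->
  (forall t, 0 <= ra t) -> (forall t, 0 <= rb t) ->
  (forall x t, 0 <= al x t <= C * ra t) -> (forall y t, 0 <= be y t <= C * rb t) ->
  (forall x y, \sum_(t <- l) al x t * be y t = 1) ->
  \sum_(t <- l) ra t * rb t = 1 ->
  \sum_z mu z * \sum_(t <- l) al z.1 t * be z.2 t * (out t == f z)%:R <=
  2^-1 + eps + C ^+ 2 * delta / 2.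
Proof.
move=> d0 /andP[e0 e2] C0 [mu0 mu1] [rho0 rho1] disc ra0 rb0 alC beC sab srr.
pose wrong t := \sum_z mu z * (al z.1 t * be z.2 t) * (f z == ~~ out t)%:R.
have -> : \sum_z mu z * \sum_(t <- l) al z.1 t * be z.2 t * (out t == f z)%:R =
    1 - \sum_(t <- l) wrong t.
  rewrite -[X in _ = X - _]mu1 exchange_big /= -sumrB; apply: eq_bigr => z _.
  rewrite -[X in _ = X - _]mulr1 -[X in _ = _ * X - _](sab z.1 z.2) !mulr_sumr -sumrB.
  apply: eq_bigr => t _; rewrite (eq_sym (f z)).
  by case: (out t); case: (f z); rewrite /= ?mulr1 ?mulr0 ?subr0 ?subrr.
have : (2^-1 - eps) * (1 - delta * C ^+ 2) <= \sum_(t <- l) wrong t.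
  have -> : (2^-1 - eps) * (1 - delta * C ^+ 2) = \sum_(t <- l) (2^-1 - eps) *
      (\sum_z rho z * (al z.1 t * be z.2 t) - delta * (C * ra t * (C * rb t))).
    rewrite -mulr_sumr; congr (_ * _); rewrite sumrB exchange_big /=; congr (_ - _).
      by rewrite -[LHS]rho1; apply: eq_bigr => z _; rewrite -mulr_sumr sab mulr1.
    rewrite -[LHS]mulr1 -[X in _ * X = _]srr mulr_sumr; apply: eq_bigr => t _; ring.
  apply: ler_sum => t _; exact: (rel_disc_product _ d0 e2 mu0 disc (mulr_ge0 C0 (ra0 t))
    (mulr_ge0 C0 (rb0 t)) (alC^~ t) (beC^~ t)).
by have := mulr_ge0 e0 (mulr_ge0 d0 (sqr_ge0 C)); nra.
Qed.

(** * Success and information *)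

Lemma tmarg_eq0 (R : realType) (X Y : finType) (mu : X * Y -> R)
    (P : protocol R X Y) z t :
  (forall z, 0 <= mu z) -> wf_prot P -> mu z != 0 ->
  tmarg mu P t = 0 -> tprob P z.1 z.2 t = 0.
Proof.
move=> mu0 wfP muz m0.
have pos y : true -> 0 <= mu y * tprob P y.1 y.2 t.
  move=> _; rewrite mulr_ge0 // tprob_sval mulr_ge0 // sval_ge0 //.
    exact: unit_alice.
  exact: unit_bob.
have /eqP : mu z * tprob P z.1 z.2 t = 0 := psumr_eq0P pos m0 isT.
by rewrite mulf_eq0 (negPf muz) => /eqP.
Qed.

Lemma ln2_gt0 (R : realType) : 0 < ln 2 :> R.
Proof. by rewrite ln_gt0 // ltr1n. Qed.

Lemma ext_info_ln (R : realType) (X Y : finType) (mu : X * Y -> R)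
    (P : protocol R X Y) :
  ext_info mu P * ln 2 = \sum_z mu z * \sum_(t <- leaves P)
    tprob P z.1 z.2 t * ln (tprob P z.1 z.2 t / tmarg mu P t).
Proof.
rewrite /ext_info exchange_big mulr_suml; apply: eq_bigr => z _ /=.
rewrite mulr_suml mulr_sumr; apply: eq_bigr => t _.
case: eqP => [e|_]; first by rewrite mul0r mulrA e mul0r.
by rewrite /log2 -[LHS]mulrA divfK ?mulrA // gt_eqF // ln2_gt0.
Qed.

(* Replacing both strategies by their clamped versions costs the mass of the
   transcripts that overshoot, which the information cost controls; the clamped
   protocol is then a small combination of rectangles. *)
Lemma success_le_info (R : realType) (X Y : finType) (f : X * Y -> bool)
    (mu rho : X * Y -> R) (P : protocol R X Y) (eps delta C : R) :
  0 <= delta -> 0 <= eps <= 2^-1 -> 1 <= C -> 0 <= ln C - 1 ->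
  is_dist mu -> is_dist rho -> rel_disc_wrt f mu eps delta rho -> wf_prot P ->
  (success mu f P - (2^-1 + eps + C ^+ 2 * delta / 2)) * (ln C - 1) <=
  ext_info mu P * ln 2.
Proof.
move=> d0 e01 C1 lC mud rhod disc wfP; have [mu0 mu1] := mud.
have C0 : 0 <= C by exact: le_trans C1.
pose T := shape P; pose m := mean_strategy mu P.
have um : unit_strategy m by exact: unit_mean_strategy.
have ua x : unit_strategy (alice P x) by exact: unit_alice.
have ub y : unit_strategy (bob P y) by exact: unit_bob.
have C11 : (0 : R) <= 1 <= C * 1 by rewrite ler01 mulr1.
(* Each input gets its own clamped strategy, all against the same reference [m]. *)
have [sta staP] := fin_all_exists (fun x =>
  clamped_strategy true T C0 ler01 C11 (ua x) um).
have [stb stbP] := fin_all_exists (fun y =>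
  clamped_strategy false T C0 ler01 C11 (ub y) um).
pose ra := sval true T m; pose rb := sval false T m.
pose cA x := crosses true C T (alice P x) m 1 1.
pose cB y := crosses false C T (bob P y) m 1 1.
pose a x := sval true T (alice P x); pose b y := sval false T (bob P y).
pose tau z t := a z.1 t * b z.2 t.
pose al x := sval true T (sta x); pose be y := sval false T (stb y).
have tau_ge0 z t : 0 <= tau z t by rewrite mulr_ge0 // sval_ge0.
have clamped : \sum_z mu z * \sum_(t <- tleaves T)
    al z.1 t * be z.2 t * (output P t == f z)%:R <= 2^-1 + eps + C ^+ 2 * delta / 2.
  apply: (bounded_success (output P) (al := al) (be := be) (ra := ra)
    (rb := rb) d0 e01 C0 mud rhod disc).
  - by move=> t; exact: sval_ge0.
  - by move=> t; exact: sval_ge0.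
  - move=> x t; have [u le _] := staP x; rewrite sval_ge0 //=.
    by have := le t; rewrite !mul1r.
  - move=> y t; have [u le _] := stbP y; rewrite sval_ge0 //=.
    by have := le t; rewrite !mul1r.
  - by move=> x y; exact: sum_sval.
  - exact: sum_sval.
pose loss z := \sum_(t <- tleaves T | cA z.1 t) tau z t +
               \sum_(t <- tleaves T | cB z.2 t) tau z t.
have succ_le : success mu f P <= 2^-1 + eps + C ^+ 2 * delta / 2 + \sum_z mu z * loss z.
  apply: (le_trans _ (lerD clamped (lexx _))).
  rewrite /success leaves_shape -big_split; apply: ler_sum => z _ /=.
  rewrite -mulrDr ler_wpM2l // /loss !(big_mkcond (cA _)) !(big_mkcond (cB _)).
  rewrite -!big_split; apply: ler_sum => t _ /=; rewrite tprob_sval -/(tau z t).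
  have [ua' _ geA] := staP z.1; have [ub' _ geB] := stbP z.2.
  have ab0 : 0 <= al z.1 t * be z.2 t by rewrite mulr_ge0 // sval_ge0.
  have lt1 : tau z t * (output P t == f z)%:R <= tau z t.
    by rewrite ler_piMr // lern1 leq_b1.
  have ab1 : 0 <= al z.1 t * be z.2 t * (output P t == f z)%:R by rewrite mulr_ge0.
  have tz := tau_ge0 z t.
  (* A transcript on which a player overshoots is charged to [loss]; on the others both clamped
     factors dominate the true ones. *)
  case: ifPn => [_|ncA]; first by case: ifP => _; lra.
  case: ifPn => [_|ncB]; first by lra.
  rewrite !addr0 ler_wpM2r // ler_pM ?sval_ge0 //.
    by have := geA 1 t; rewrite ler01 lexx !mul1r; apply.
  by have := geB 1 t; rewrite ler01 lexx !mul1r; apply.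
rewrite ext_info_ln; apply: (@le_trans _ _ ((\sum_z mu z * loss z) * (ln C - 1))).
  by rewrite ler_wpM2r // lerBlDl.
rewrite mulr_suml; apply: ler_sum => z _; rewrite -mulrA.
have [->|muz] := eqVneq (mu z) 0; first by rewrite !mul0r.
rewrite ler_wpM2l // leaves_shape -/T /loss.
have tmE t : tmarg mu P t = ra t * rb t.
  by rewrite -mean_strategy_tmarg // mu1 mul1r.
under [leRHS]eq_bigr => t _ do rewrite tmE tprob_sval.
apply: (@kl_product R _ _ (a z.1) (b z.2) ra rb) => // [t|t|t|t|t|||||];
  try exact: sval_ge0.
- by move=> rr; rewrite -tprob_sval; apply: (tmarg_eq0 mu0 wfP muz); rewrite tmE.
- exact: (sum_sval true).
- exact: (sum_sval true).
- exact: (sum_sval false).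
- by have := crosses_mass true C T 1 1 (ua z.1) um (ub z.2); rewrite !mul1r.
- have := crosses_mass false C T 1 1 (ub z.2) um (ua z.1); rewrite !mul1r.
  by under [leRHS]eq_bigr => t _ do rewrite mulrC.
Qed.

(** * The trivial bound and the case of zero information *)

Lemma success_le1 (R : realType) (X Y : finType) (f : X * Y -> bool)
    (mu : X * Y -> R) (P : protocol R X Y) :
  is_dist mu -> wf_prot P -> success mu f P <= 1.
Proof.
move=> [mu0 mu1] wfP; rewrite -[leRHS]mu1; apply: ler_sum => z _.
rewrite ler_piMr // -[leRHS](sum_sval true (shape P) (alice P z.1) (bob P z.2)).
rewrite leaves_shape; apply: ler_sum => t _; rewrite tprob_sval ler_piMr //.
  by rewrite mulr_ge0 // sval_ge0 //; [exact: unit_alice | exact: unit_bob].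
by rewrite lern1 leq_b1.
Qed.

(** Compare with [guess], the success when the transcript is drawn from its average law
    independently of the input. [kl_event] with [s = 1 + eps] gives [success <= (1 + eps) * guess],
    without showing that the two laws agree. *)
Lemma success_no_info (R : realType) (X Y : finType) (f : X * Y -> bool)
    (mu rho : X * Y -> R) (P : protocol R X Y) (eps delta : R) :
  delta <= 1 -> 0 < eps -> is_dist mu -> is_dist rho ->
  rel_disc_wrt f mu eps delta rho -> wf_prot P -> ext_info mu P <= 0 ->
  success mu f P <= 2^-1 + 2 * eps.
Proof.
move=> d1 e0 [mu0 mu1] [rho0 rho1] disc wfP info0.
pose T := shape P; pose m := mean_strategy mu P.
have um : unit_strategy m by exact: unit_mean_strategy.
pose r t := tmarg mu P t.
have rE t : r t = sval true T m t * sval false T m t.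
  by rewrite /r -mean_strategy_tmarg // mu1 mul1r.
have r_ge0 t : 0 <= r t by rewrite rE mulr_ge0 // sval_ge0.
have sum_r : \sum_(t <- leaves P) r t = 1.
  by rewrite leaves_shape; under eq_bigr do rewrite rE; exact: (sum_sval true).
(* The full rectangle has [rho] mass [1 >= delta], so any constant answer is right with probability
   at most [2^-1 + eps]. *)
have fb b : \sum_z mu z * (b == f z)%:R <= 2^-1 + eps.
  have full : rect_meas rho setT setT = 1.
    by rewrite /rect_meas -rho1; apply: eq_bigl => z; rewrite !in_setT.
  have val c : rect_meas_val mu f c setT setT = \sum_z mu z * (c == f z)%:R.
    rewrite /rect_meas_val big_mkcond; apply: eq_bigr => z _.
    by rewrite !in_setT eq_sym /=; case: eqP; rewrite ?mulr1 ?mulr0.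
  have tot : \sum_z mu z * (b == f z)%:R + \sum_z mu z * (~~ b == f z)%:R = 1.
    rewrite -[RHS]mu1 -big_split; apply: eq_bigr => z _ /=.
    by case: (b); case: (f z); rewrite /= ?mulr1 ?mulr0 ?addr0 ?add0r.
  have := disc setT setT; rewrite full => /(_ d1); rewrite !val !mulr1.
  by move: tot; case: (b) => /= tot []; lra.
pose guess := \sum_z mu z * \sum_(t <- leaves P) r t * (output P t == f z)%:R.
have guess_le : guess <= 2^-1 + eps.
  rewrite /guess; under eq_bigr do rewrite mulr_sumr.
  rewrite exchange_big /= -[leRHS]mulr1 -[X in _ <= _ * X]sum_r mulr_sumr.
  apply: ler_sum => t _; under eq_bigr do rewrite mulrCA.
  by rewrite -mulr_sumr mulrC ler_wpM2r.
have s0 : 0 < 1 + eps by lra.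
have kl : success mu f P * ln (1 + eps) - eps * guess <= ext_info mu P * ln 2.
  rewrite ext_info_ln /success /guess mulr_suml mulr_sumr -sumrB.
  apply: ler_sum => z _; rewrite -mulrA (mulrCA eps) -mulrBr.
  have [->|muz] := eqVneq (mu z) 0; first by rewrite !mul0r.
  rewrite ler_wpM2l //.
  have pick (g : seq bool -> R) :
      \sum_(t <- leaves P) g t * (output P t == f z)%:R =
      \sum_(t <- leaves P | output P t == f z) g t.
    by rewrite [RHS]big_mkcond; apply: eq_bigr => t _; case: eqP;
      rewrite ?mulr1 ?mulr0.
  rewrite !pick.
  have := @kl_event R _ (leaves P) (fun t => tprob P z.1 z.2 t) r
    (fun t => output P t == f z) (1 + eps) s0.
  rewrite [1 + eps - 1]addrC addKr; apply => //.
  - move=> t; rewrite tprob_sval mulr_ge0 // sval_ge0 //.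
      exact: unit_alice.
    exact: unit_bob.
  - by move=> t; exact: tmarg_eq0.
  - rewrite leaves_shape; under eq_bigr do rewrite tprob_sval.
    exact: (sum_sval true).
(* From [ln u <= u - 1] at [u = (1 + eps)^-1]. *)
have ln_ge : eps <= (1 + eps) * ln (1 + eps).
  have sv : 0 < (1 + eps)^-1 by rewrite invr_gt0.
  have u1 : -1 < (1 + eps)^-1 - 1 by lra.
  have := le_ln1Dx u1; rewrite (addrC 1) subrK lnV ?posrE // -(ler_pM2l s0).
  by rewrite mulrBr divff ?gt_eqF // mulrN mulr1; lra.
have succ0 : 0 <= success mu f P.
  apply: sumr_ge0 => z _; rewrite mulr_ge0 //; apply: sumr_ge0 => t _.
  rewrite mulr_ge0 // tprob_sval mulr_ge0 // sval_ge0 //.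
    exact: unit_alice.
  exact: unit_bob.
have succ1 := success_le1 f (conj mu0 mu1) wfP.
have info0' : ext_info mu P * ln 2 <= 0 by rewrite mulr_le0_ge0 // ltW // ln2_gt0.
have : eps * success mu f P <= eps * ((1 + eps) * guess).
  have := ler_wpM2r succ0 ln_ge.
  have : (1 + eps) * (success mu f P * ln (1 + eps)) <= (1 + eps) * (eps * guess).
    by rewrite ler_wpM2l; lra.
  by lra.
rewrite (ler_pM2l e0) => le.
have g1 : guess <= 1.
  rewrite -[leRHS]mu1; apply: ler_sum => z _; rewrite ler_piMr // -[leRHS]sum_r.
  by apply: ler_sum => t _; rewrite ler_piMr // lern1 leq_b1.
nra.
Qed.

(** * Choice of the clamping constant and the final estimate *)

Theorem theorem3p3 (R : realType) (n M : nat) (delta eps : R)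
  (mu : bits n * bits n -> R) (f : bits n * bits n -> bool)
  (P : protocol R (bits n) (bits n)) :
  0 < delta -> delta < 1 -> 0 < eps ->
  is_dist mu -> rel_disc f mu eps delta ->
  wf_prot P -> ext_info mu P <= M%:R ->
  success mu f P <= 2^-1 + 2000 * Num.max eps (M%:R / log2 (delta^-1)).
Proof.
move=> d0 d1 e0 mud [rho [rhod disc]] wfP info.
set x := M%:R / _; have xE : x = M%:R / log2 delta^-1 by [].
have [emax xmax] : eps <= Num.max eps x /\ x <= Num.max eps x.
  by rewrite !le_max !lexx orbT.
have succ1 := success_le1 f mud wfP.
(* For [M = 0] the target has no room for the clamping error; for [M >= 1] that error, of order
   [1 / l], is absorbed by [x]. *)
clearbody x; case: M info xE => [|M] info xE.
  have := success_no_info (ltW d1) e0 mud rhod disc wfP info; lra.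
have [e2|e2] := ltP 2^-1 eps; first by lra.
pose l := - ln delta.
have l0 : 0 < l by rewrite oppr_gt0 ln_lt0 // d0.
have ln2_half : 2^-1 <= ln 2 :> R.
  have h : -1 < - 2^-1 :> R by lra.
  have := le_ln1Dx h; rewrite (_ : 1 + - 2^-1 = 2^-1 :> R); last by lra.
  by rewrite lnV ?posrE // lerN2.
have xl : x * l = M.+1%:R * ln 2.
  rewrite xE /log2 lnV ?posrE // -/l invf_div mulrA -mulrA mulVf ?mulr1 //.
  by rewrite gt_eqF.
have M1 : 1 <= M.+1%:R :> R by rewrite ler1n.
have xl2 : 2^-1 <= x * l by rewrite xl; nra.
have x0 : 0 <= x by nra.
(* For [l < 8], [x * l >= 2^-1] gives [x > 1/16] and the bound exceeds 1. Otherwise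
   [l / 4 - 1 >= l / 8]. *)
have [l8|l8] := ltP l 8; first by nra.
have lnC : ln (expR (l / 4)) = l / 4 by exact: expRK.
have C1 : 1 <= expR (l / 4) by have := expR_ge1Dx (l / 4); lra.
have := @success_le_info R _ _ f mu rho P eps delta (expR (l / 4)) (ltW d0).
rewrite lnC (ltW e0) e2 => /(_ isT C1) => /(_ _ mud rhod disc wfP) main.
have {}main := main ltac:(lra).
(* With [C = delta^(-1/4)] the left side is [expR (- (l / 2))], and [expR u >= 1 + u]. *)
have Cd : expR (l / 4) ^+ 2 * delta <= 2 / l.
  rewrite -[delta]lnK ?posrE // -expRM_natl -expRD.
  have -> : 2 * (l / 4) + ln delta = - (l / 2) by rewrite /l; lra.
  rewrite expRN -[2 / l]invf_div lef_pV2 ?posrE ?expR_gt0 ?divr_gt0 //.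
  by have := expR_ge1Dx (l / 2); lra.
have lx : l^-1 <= 2 * x.
  by rewrite -(ler_pM2r l0) mulVf ?gt_eqF //; lra.
have infol : ext_info mu P * ln 2 <= x * l.
  by rewrite xl ler_wpM2r //; lra.
set B := _ + _ + _ in main.
(* Divide [main] by [l / 4 - 1 >= l / 8]. The total excess over one half is then at most
   [eps + 2 * x + 8 * x]. *)
have succB : success mu f P - B <= 8 * x.
  have [|sB] := leP (success mu f P - B) 0; first by lra.
  rewrite -(ler_pM2r l0); nra.
rewrite /B in succB; lra.
Qed.
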